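(* Let $G$ be a finite abelian group whose Sylow $2$-subgroup is $P=\langle a_1\rangle\times\dots\times\langle a_n\rangle$, where $a_i$ has order $2^{m_i}>1$ for $1\le i\le n$. Let $H$ be a subgroup of $G$ such that $H\cap P$ is cyclic. (a) $H$ is a perfect code of $G$ if and only if either $H\cap P$ is trivial or the projection of $H\cap P$ onto $\langle a_i\rangle$ (with respect to the given direct decomposition of $P$) equals $\langle a_i\rangle$ for at least one $i\in\{1,\dots,n\}$. (b) $H$ is a total perfect code of $G$ if and only if the projection of $H\cap P$ onto $\langle a_i\rangle$ equals $\langle a_i\rangle$ for at least one $i\in\{1,\dots,n\}$.
   Context: All groups and graphs are finite; $e$ denotes the identity. For a group $G$ and $S\subseteq G$ with $e\notin S$ and $S^{-1}=S$, the Cayley graph $\mathrm{Cay}(G,S)$ has vertex set $G$, with $x,y$ adjacent iff $yx^{-1}\in S$. A subset $C$ of the vertex set of a graph is a perfect code if every vertex is at distance at most one from exactly one vertex of $C$; it is a total perfect code if every vertex has exactly one neighbour in $C$. A subset $C\subseteq G$ is called a perfect code (resp. total perfect code) of $G$ if it is a perfect code (resp. total perfect code) in some Cayley graph $\mathrm{Cay}(G,S)$ of $G$. *)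

(* Defs.v *)
From mathcomp Require Import all_boot all_fingroup all_solvable.

Set Implicit Arguments.
Unset Strict Implicit.
Unset Printing Implicit Defensive.

Local Open Scope group_scope.

(* A graph is given by its vertex set V and its adjacency relation e, which is
   expected to relate only elements of V. *)
Section Codes.
Variable T : finType.
Implicit Types (V C : {set T}) (e : rel T).

Definition dist_le e (k : nat) (x y : T) : Prop :=
  exists p : seq T, [/\ path e x p, last x p = y & (size p <= k)%N].

Definition perfect_code V e C : Prop :=
  C \subset V /\
  forall v, v \in V -> exists! c, c \in C /\ dist_le e 1 v c.

Definition total_perfect_code V e C : Prop :=
  C \subset V /\
  forall v, v \in V -> exists! c, c \in C /\ e v c.

Lemma dist_le1P e x y : dist_le e 1 x y <-> x = y \/ e x y.
Proof.
split=> [[[|z [|? ?]] []] //= | [-> | exy]]; first by left.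
- by rewrite andbT => exz <- _; right.
- by exists [::].
by exists [:: y]; rewrite /= exy.
Qed.

End Codes.

Section Cayley.
Variable gT : finGroupType.
Implicit Types (G S C : {set gT}).

Definition connection_set G S : Prop :=
  [/\ S \subset G, 1 \notin S & S^-1 = S].

Definition cayley_adj G S : rel gT :=
  [rel x y | [&& x \in G, y \in G & y * x^-1 \in S]].

Definition group_perfect_code G C : Prop :=
  exists S, connection_set G S /\ perfect_code G (cayley_adj G S) C.

Definition group_total_perfect_code G C : Prop :=
  exists S, connection_set G S /\ total_perfect_code G (cayley_adj G S) C.

End Cayley.

Section Projection.
Variables (gT : finGroupType) (I : finType).

(* When the product of the F j is direct, the product K of the F j with j != i
   is a complement to F i, and divgr (F i) K x is the F i-component of x (see
   dprod_projE). *)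
Definition dprod_proj (F : I -> {set gT}) (i : I) (x : gT) : gT :=
  divgr (F i) (\prod_(j | j != i) F j) x.

Lemma dprod_projE (F : I -> {group gT}) (P : {group gT}) (c : I -> gT) i :
    \big[dprod/1]_j F j = P -> (forall j, c j \in F j) ->
  dprod_proj F i (\prod_j c j) = c i.
Proof.
move=> defP Fc; have defP' := defP; rewrite (bigD1 i) //= in defP'.
have [[_ K _ defK] _ cFK tiFK] := dprodP defP'; rewrite defK in cFK tiFK.
have cc : {in [set: I] &, forall j k, commute (c j) (c k)}.
  move=> j k _ _; have [-> // | neq_jk] := eqVneq j k.
  move: defP; rewrite (bigD1 j) //= => /dprodP[[_ L _ defL] _ cFL _].
  rewrite defL in cFL; apply/esym/(centsP cFL) => //.
  rewrite -(bigdprodW defL); have Lk : k != j by rewrite eq_sym.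
  apply/prodsgP; exists (fun l => if l == k then c k else 1) => [l _|].
    by case: eqP => [-> | _] /=; rewrite ?group1.
  rewrite -big_mkcondr /= (big_pred1 k) // => l /=.
  by have [-> | _] := eqVneq l k; rewrite ?Lk ?andbF.
have -> : \prod_j c j = c i * \prod_(j | j != i) c j.
  have [s1 [s2]] : exists s1 s2, index_enum I = s1 ++ i :: s2.
    have /splitPr[s1 s2] : i \in index_enum I by rewrite mem_index_enum.
    by exists s1, s2.
  move=> def_s; have := index_enum_uniq I.
  rewrite def_s cat_uniq /= negb_or => /and3P[_ /andP[s1i _] /andP[s2i _]].
  rewrite !big_cat !big_cons /= eqxx mulgA.
  have E s : i \notin s -> \prod_(j <- s | j != i) c j = \prod_(j <- s) c j.
    move=> si; rewrite big_seq_cond [RHS]big_seq_cond; apply: eq_bigl => j.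
    by case: (boolP (j \in s)) => //= js; apply: contraNneq si => <-.
  rewrite !E // mulgA; congr (_ * _).
  elim: (s1) => [|j s IHs]; first by rewrite big_nil mul1g mulg1.
  rewrite !big_cons -mulgA IHs !mulgA; congr (_ * _).
  by apply: cc; rewrite inE.
rewrite /dprod_proj (bigdprodW defK) divgrMid //.
by rewrite -(bigdprodW defK) mem_prodg.
Qed.

End Projection.

(* Main.v *)
Require Import Defs.
From mathcomp Require Import all_boot all_fingroup all_solvable.

(* Perfect codes H (resp. total perfect codes) correspond to inverse-closed
   transversals of H in G that contain (resp. do not contain) 1.  A coset H x
   with x^2 in H is its own inverse, so its representative must have square 1;
   the other cosets come in pairs C <> C^-1 and impose no constraint.  For G
   abelian this says that an element of H which is a square in G is already a
   square in H, a condition that only involves 2-parts.  If H :&: P = <[z]> is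
   nontrivial, then z is not a square in <[z]>, so the condition says that z is
   not a square in P; equivalently some component of z is not a square in
   <[a i]>, i.e. generates <[a i]>.  For total codes the representative of H
   itself is an involution, so H :&: P must moreover be nontrivial. *)

Local Open Scope group_scope.

(** * Perfect codes as inverse-closed transversals *)

Section InvTransversal.
Set Implicit Arguments.
Unset Strict Implicit.

Variable gT : finGroupType.
Implicit Types (G H : {group gT}) (T : {set gT}).

(** For [c] in the subgroup [H], the products [c * v^-1] run over [H :* v^-1], so [T] meets every
    right coset of [H] exactly once. This form matches Cayley adjacency. *)
Definition inv_transversal (G H T : {set gT}) : Prop :=
  [/\ T \subset G, T^-1 = T
    & forall v, v \in G -> exists! c, c \in H /\ c * v^-1 \in T].

Definition coset_involutive (G H : {set gT}) : Prop :=
  forall x, x \in G -> x ^+ 2 \in H -> exists2 h, h \in H & (h * x) ^+ 2 = 1.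

(** [T] corresponds to [1 |: S]: distance at most one from [v] to [c] means
    [c * v^-1 \in 1 |: S]. *)
Lemma group_perfect_codeP G H : H \subset G ->
  group_perfect_code G H <-> exists2 T, inv_transversal G H T & 1 \in T.
Proof.
move=> sHG; split=> [[S [[sSG S1 SV] [_ codeH]]] | [T [sTG TV trT] T1]].
  exists (1 |: S); last by rewrite setU11.
  split=> [||v Gv]; first by rewrite subUset sub1set group1.
    apply/setP=> y; rewrite mem_invg !in_setU1 invg_eq1 -[in RHS]SV.
    by rewrite mem_invg.
  have [c [[Hc /dist_le1P vc] uniq_c]] := codeH v Gv.
  exists c; split=> [|d [Hd Td]].
    split=> //; rewrite in_setU1 -eq_mulgV1; case: vc => [-> | /and3P[_ _ ->]].
      by rewrite eqxx.
    by rewrite orbT.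
  apply: uniq_c; split=> //; apply/dist_le1P.
  move: Td; rewrite in_setU1 -eq_mulgV1 => /predU1P[-> | Sd]; first by left.
  by right; apply/and3P; split=> //; apply: (subsetP sHG).
exists (T :\ 1); split.
  split; [exact: subset_trans (subD1set _ _) sTG | by rewrite !inE eqxx |].
  by apply/setP=> y; rewrite mem_invg !in_setD1 invg_eq1 -[in RHS]TV mem_invg.
split=> // v Gv; have [c [[Hc Tc] uniq_c]] := trT v Gv.
exists c; split=> [|d [Hd /dist_le1P vd]].
  split=> //; apply/dist_le1P; have [-> | neq_cv] := eqVneq c v; first by left.
  right; apply/and3P; split=> //; first exact: (subsetP sHG).
  by rewrite in_setD1 -eq_mulgV1 neq_cv.
apply: uniq_c; split=> //; case: vd => [<- | /and3P[_ _]].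
  by rewrite mulgV.
by rewrite in_setD1 => /andP[].
Qed.

Lemma group_total_perfect_codeP G H : H \subset G ->
  group_total_perfect_code G H <->
  exists2 T, inv_transversal G H T & 1 \notin T.
Proof.
move=> sHG; have adjE T v c : v \in G ->
    (c \in H /\ cayley_adj G T v c) <-> (c \in H /\ c * v^-1 \in T).
  move=> Gv; split=> [[Hc /and3P[]] // | [Hc Tc]].
  by split=> //; apply/and3P; split=> //; apply: (subsetP sHG).
split=> [[T [[sTG T1 TV] [_ codeH]]] | [T [sTG TV trT] T1]]; exists T => //.
  split=> // v Gv; have [c [/(adjE _ _ _ Gv) cP uniq_c]] := codeH v Gv.
  by exists c; split=> // d /(adjE _ _ _ Gv); apply: uniq_c.
split=> //; split=> // v Gv; have [c [/(adjE _ _ _ Gv) cP uniq_c]] := trT v Gv.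
by exists c; split=> // d /(adjE _ _ _ Gv); apply: uniq_c.
Qed.

(** If [c * x^-1] is in [T], so is its inverse [x * c^-1]. When [x ^+ 2 \in H] both lie in
    [H :* x^-1], hence coincide, and [x * c^-1] has square 1. *)
Lemma inv_transversal_involutive G H T :
  H <| G -> inv_transversal G H T -> coset_involutive G H.
Proof.
case/andP=> _ nHG [_ TV trT] x Gx Hx2.
have [c [[Hc Tc] uniq_c]] := trT x Gx.
have Hcx : x * c^-1 * x^-1 \in H.
  have := memJ_norm c^-1 (subsetP nHG _ (groupVr Gx)).
  by rewrite conjgE invgK mulgA groupV Hc.
have eq_c : c = x * c^-1 * x.
  apply: uniq_c; split.
    by have := groupM Hcx Hx2; rewrite expgS expg1 -!mulgA mulKg.
  by rewrite mulgK -TV mem_invg invMg invgK.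
exists (x * c^-1 * x^-1) => //.
by rewrite mulgKV expgS expg1 mulgA -eq_c mulgV.
Qed.

(** Representatives are chosen compatibly with inversion: [t] in [H], an element of square 1 in any
    other coset that has one, and mutually inverse elements in the remaining pairs. Perfect codes
    use [t = 1], total ones an involution. *)
Lemma coset_involutive_transversal G H t :
    H <| G -> coset_involutive G H -> t \in H -> t ^+ 2 = 1 ->
  exists2 T, inv_transversal G H T & t \in T.
Proof.
case/andP=> sHG nHG invH Ht t2.
have invE (u : gT) : u ^+ 2 = 1 -> u^-1 = u.
  by move=> u2; apply: (mulgI u); rewrite mulgV -expg2.
have cosV y : y \in G -> (H :* y)^-1 = H :* y^-1.
  move=> Gy; rewrite invg_rcoset norm_rlcoset //.
  by rewrite (subsetP nHG) ?groupV.
(* The rank breaks the symmetry between C and C^-1. *)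
pose g (C : {set gT}) :=
  if C == H then t else
  if [pick u in C | u ^+ 2 == 1] is Some u then u else
  if enum_rank C < enum_rank C^-1 then repr C else (repr C^-1)^-1.
have g_mem x : x \in G -> g (H :* x) \in H :* x.
  move=> Gx; rewrite /g; case: eqP => [-> // | _].
  case: pickP => [u /andP[] // | _].
  rewrite cosV //; case: ifP => _; first exact: mem_repr_rcoset.
  by rewrite -mem_invg cosV // mem_repr_rcoset.
have gV x : x \in G -> g (H :* x^-1) = (g (H :* x))^-1.
  move=> Gx; rewrite -cosV // /g.
  have -> : ((H :* x)^-1 == H) = (H :* x == H).
    by rewrite -(inj_eq invg_inj) invgK invGid.
  case: eqP => [_ | _]; first by rewrite invE.
  (* A self-inverse coset contains an element of square 1 by [invH], so [g] never reaches its rank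
     test there. *)
  have [eqC | neqC] := eqVneq (H :* x)^-1 (H :* x).
    rewrite eqC; case: pickP => [u /andP[_ /eqP/invE->] // | noinv].
    have Hx2 : x ^+ 2 \in H.
      have: x \in H :* x^-1 by rewrite -cosV // eqC rcoset_refl.
      by rewrite mem_rcoset invgK.
    have [h Hh hx2] := invH x Gx Hx2.
    by have:= noinv (h * x); rewrite /= hx2 eqxx andbT mem_rcoset mulgK Hh.
  (* An element of square 1 would lie in both [H :* x] and its inverse, making them equal; so here
     [g] uses the rank test. *)
  have noinv u : u ^+ 2 = 1 -> u \notin H :* x.
    move=> u2; apply: contra neqC => xu.
    have xu' : u \in (H :* x)^-1 by rewrite mem_invg invE.
    by rewrite cosV // in xu' *; rewrite -(rcoset_eqP xu) -(rcoset_eqP xu').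
  case: pickP => [u /andP[xu /eqP u2] | _].
    by move: xu; rewrite mem_invg invE // => xu; case/negP: (noinv u u2).
  case: pickP => [u /andP[xu /eqP u2] | _]; first by case/negP: (noinv u u2).
  rewrite !invgK; case: ltngtP => // [_ | eq_rank]; first by rewrite invgK.
  by case/eqP: neqC; apply/enum_rank_inj/val_inj.
exists [set y in G | g (H :* y) == y]; last first.
  by rewrite inE (subsetP sHG) //= rcoset_id // /g eqxx.
split=> [||v Gv]; first by apply/subsetP=> y /setIdP[].
  apply/setP=> y; rewrite mem_invg !inE groupV.
  by apply: andb_id2l => Gy; rewrite gV // (inj_eq invg_inj).
have Gv' : v^-1 \in G by rewrite groupV.
have gmem := g_mem _ Gv'.
(* The element of [T] in [H :* v^-1] is [g (H :* v^-1)], which must equal [c * v^-1]. *)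
exists (g (H :* v^-1) * v); split=> [|d [Hd]].
  split; first by rewrite mem_rcoset invgK in gmem.
  rewrite mulgK inE (rcoset_eqP gmem) eqxx andbT.
  case/rcosetP: gmem => h Hh ->.
  by rewrite groupM // (subsetP sHG).
by case/setIdP=> _ /eqP; rewrite rcosetM rcoset_id // => ->; rewrite mulgKV.
Qed.

Lemma group_perfect_code_normalP G H : H <| G ->
  group_perfect_code G H <-> coset_involutive G H.
Proof.
move=> nsHG; split.
  case/group_perfect_codeP=> [|T trT _]; first exact: normal_sub.
  exact: inv_transversal_involutive trT.
move=> invH; apply/group_perfect_codeP; first exact: normal_sub.
exact: coset_involutive_transversal (group1 H) (expg1n _ _).
Qed.

(** By uniqueness the representative of [H] is its own inverse, so it is an involution as soon as it
    is not 1. Conversely, Cauchy's theorem gives an involution to prescribe as representative. *)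
Lemma group_total_perfect_code_normalP G H : H <| G ->
  group_total_perfect_code G H <-> coset_involutive G H /\ 2 %| #|H|.
Proof.
move=> nsHG; have sHG := normal_sub nsHG; split.
  case/(group_total_perfect_codeP sHG)=> T trT T1.
  split; first exact: inv_transversal_involutive trT.
  have [_ TV trT1] := trT; have [t [[Ht Tt] uniq_t]] := trT1 1 (group1 G).
  rewrite invg1 mulg1 in Tt.
  have tV : t = t^-1.
    by apply: uniq_t; rewrite groupV invg1 mulg1 -TV mem_invg invgK.
  have t2 : #[t] = 2.
    apply: nt_prime_order => //; first by rewrite expg2 {2}tV mulgV.
    by apply: contraNneq T1 => <-.
  by rewrite -t2 order_dvdG.
case=> invH /(Cauchy (isT : prime 2))[t Ht ot].
have t2 : t ^+ 2 = 1 by rewrite -ot expg_order.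
have [T trT Tt] := coset_involutive_transversal nsHG invH Ht t2.
apply/(group_total_perfect_codeP sHG); exists T => //.
(* Otherwise [1] and [t] would both represent [H]. *)
apply/negP=> T1; have [_ _ /(_ 1 (group1 G))[c [_ uniq_c]]] := trT.
have: #[t] = 1%N.
  apply/eqP; rewrite order_eq1 -(uniq_c t) ?invg1 ?mulg1 //.
  by rewrite (uniq_c 1) // invg1 mulg1.
by rewrite ot.
Qed.

End InvTransversal.

(** * Squares and the reduction to the Sylow 2-subgroup *)

Section Squares.
Set Implicit Arguments.
Unset Strict Implicit.

Variable gT : finGroupType.
Implicit Types (G H P : {group gT}) (x y z : gT).

Definition is_square_in (A : {set gT}) z := exists2 x, x \in A & x ^+ 2 = z.

(** In an abelian group, [(h * x) ^+ 2 = 1] says that [h^-1] is a square root of [x ^+ 2]. *)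
Lemma coset_involutive_abelianP G H : abelian G -> H \subset G ->
  coset_involutive G H <->
  (forall x, x \in G -> x ^+ 2 \in H -> is_square_in H (x ^+ 2)).
Proof.
move=> abG sHG; have sqM h x : h \in H -> x \in G ->
    (h * x) ^+ 2 = h ^+ 2 * x ^+ 2.
  move=> Hh Gx; apply: expgMn; apply: (centsP abG) => //.
  exact: (subsetP sHG).
split=> sqH x Gx Hx2; have [h Hh hx2] := sqH x Gx Hx2; exists h^-1.
- by rewrite groupV.
- by apply/eqP; rewrite expVgn eq_invg_mul -sqM // hx2.
- by rewrite groupV.
by rewrite sqM ?groupV // expVgn hx2 mulVg.
Qed.

Lemma is_square_in_odd H y : y \in H -> odd #[y] -> is_square_in H y.
Proof.
move=> Hy odd_y; exists (y ^+ (#[y].+1./2)); first exact: groupX.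
by rewrite -expgM muln2 halfK /= odd_y subn0 expgS expg_order mulg1.
Qed.

(** A root [z ^+ k] would make [k * 2] congruent to 1 modulo the even number [#[z]]. *)
Lemma not_is_square_in_cycle z : 2.-elt z -> z != 1 -> ~ is_square_in <[z]> z.
Proof.
move=> z2 nz1 [_ /cycleP[k ->]]; rewrite -expgM => zk.
have: z ^+ (k * 2) == z ^+ 1 by rewrite zk.
rewrite eq_expg_mod_order => eq_k.
have even_z : 2 %| #[z].
  move: nz1; rewrite -order_eq1 -(part_pnat_id z2) p_part.
  by case: (logn 2 #[z]) => // e _; rewrite expnS dvdn_mulr.
have: k * 2 == 1 %[mod 2].
  by rewrite -(modn_dvdm (k * 2) even_z) (eqP eq_k) modn_dvdm.
by rewrite modnMl.
Qed.

(** The odd part of [x ^+ 2] always has a root in [H]. Its 2-part is some [z ^+ k], with a root in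
    [<[z]>] if [k] is even; an odd [k] would make [z] a square in [P]. *)
Lemma coset_involutive_SylowP G P H z :
    abelian G -> 2.-Sylow(G) P -> H \subset G -> H :&: P = <[z]> ->
  coset_involutive G H <-> H :&: P = 1 \/ ~ is_square_in P z.
Proof.
move=> abG sylP sHG defQ; have sPG := pHall_sub sylP.
have nsPG : P <| G by rewrite -sub_abelian_normal.
have P2 x : x \in G -> x.`_2 \in P.
  by move=> Gx; rewrite (mem_normal_Hall sylP nsPG) ?groupX ?p_elt_constt.
have /setIP[Hz Pz] : z \in H :&: P by rewrite defQ cycle_id.
have z2 : 2.-elt z := mem_p_elt (pHall_pgroup sylP) Pz.
apply: iff_trans (coset_involutive_abelianP abG sHG) _; split=> [sqH | sqz].
  have [z1 | nz1] := eqVneq z 1; first by left; rewrite defQ z1 cycle1.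
  right=> [[x Px x2]]; have Gx := subsetP sPG x Px.
  have [|h Hh] := sqH x Gx; first by rewrite x2.
  rewrite x2 => h2; case: (not_is_square_in_cycle z2 nz1).
  (* As [z] is a 2-element, the 2-part of its root [h] is again a root, now inside [H :&: P]. *)
  exists h.`_2; last by rewrite -consttX h2 constt_p_elt.
  by rewrite -defQ inE groupX // P2 // (subsetP sHG).
move=> x Gx Hx2; have Gx2 := groupX 2 Gx.
have [h Hh h2] : is_square_in H (x ^+ 2).`_2.
  have: (x ^+ 2).`_2 \in <[z]> by rewrite -defQ inE groupX ?P2.
  case: sqz => [Q1 | nsqz].
    by rewrite -defQ Q1 => /set1P->; exists 1; rewrite ?group1 ?expg1n.
  case/cycleP=> k def_k; have [odd_k | even_k] := boolP (odd k); last first.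
    exists (z ^+ k./2); first exact: groupX.
    by rewrite def_k -expgM muln2 even_halfK.
  (* The 2-part of [x] is a root of [z ^+ k]; dividing it by [z ^+ k./2] leaves a root of [z], since
     [k] is odd. *)
  case: nsqz; exists (x.`_2 * z ^- k./2).
    by rewrite groupM ?P2 // groupV groupX.
  rewrite expgMn; last first.
    by apply: (centsP abG); rewrite ?groupV groupX // (subsetP sPG).
  rewrite -consttX def_k expVgn -expgM muln2 -{1}(odd_double_half k) odd_k.
  by rewrite expgD expg1 mulgK.
have [h' Hh' h'2] : is_square_in H (x ^+ 2).`_2^'.
  apply: is_square_in_odd; first exact: groupX.
  by rewrite odd_2'nat; apply: p_elt_constt.
exists (h * h'); first exact: groupM.
rewrite expgMn ?h2 ?h'2 ?consttC //.
by apply: (centsP abG); apply: (subsetP sHG).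
Qed.

Lemma is_square_in_prod (I : finType) P (c : I -> gT) :
    abelian P -> (forall i, is_square_in P (c i)) ->
  is_square_in P (\prod_i c i).
Proof.
move=> abP sqc; apply: big_ind => // [|_ _ [x Px <-] [y Py <-]].
  by exists 1; rewrite ?group1 ?expg1n.
exists (x * y); first exact: groupM.
by apply: expgMn; apply: (centsP abP).
Qed.

End Squares.

(** * Projections onto the cyclic factors *)

Section Projections.
Set Implicit Arguments.
Unset Strict Implicit.

Variables (gT : finGroupType) (I : finType).

Lemma dprod_projM (F : I -> {group gT}) (P : {group gT}) i :
    \big[dprod/1]_j F j = P ->
  {in P &, {morph dprod_proj F i : x y / x * y}}.
Proof.
move=> defP; rewrite (bigD1 i) //= in defP.
have [[_ K _ defK] defFK cFK tiFK] := dprodP defP.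
rewrite /dprod_proj (bigdprodW defK) defK in defFK cFK tiFK *.
by apply: divgrM => //; apply/complP.
Qed.

Lemma dprod_proj_cycle (F : I -> {group gT}) (P : {group gT}) i z :
    \big[dprod/1]_j F j = P -> z \in P ->
  dprod_proj F i @: <[z]> = <[dprod_proj F i z]>.
Proof.
move=> defP Pz; pose f := Morphism (dprod_projM i defP).
have sZP : <[z]> \subset P by rewrite cycle_subG.
by have:= morphim_cycle f Pz; rewrite /morphim (setIidPr sZP).
Qed.

(** A square in [P] has square projections, but a generator of [<[a i]>] is not a square there. If
    no projection is onto, each component of [z] is an even power of its [a i], so [z] is a
    square. *)
Lemma dprod_proj_cycle_fullP (P : {group gT}) (a : I -> gT) z :
    \big[dprod/1]_i <[a i]> = P -> abelian P ->
    (forall i, 2.-elt (a i)) -> (forall i, a i != 1) -> z \in P ->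
  (exists i, dprod_proj (fun j => <[a j]>) i @: <[z]> = <[a i]>) <->
  ~ is_square_in P z.
Proof.
move=> defP abP a2 nt_a Pz.
have projE i := @dprod_proj_cycle (fun j => <[a j]>%G) P i z defP Pz.
have aP i x : x \in <[a i]> -> x \in P.
  move: x; apply/subsetP; have := defP; rewrite (bigD1 i) //=.
  by case/dprodP=> [[_ K _ ->] <- _ _]; apply: mulG_subl.
split=> [[i] | nsqz].
  rewrite projE => full [x Px x2]; pose w := dprod_proj (fun j => <[a j]>) i x.
  have w2 : dprod_proj (fun j => <[a j]>) i z = w ^+ 2.
    by rewrite -x2 !expg2 (dprod_projM (F := fun j => <[a j]>%G) i defP).
  have aw : w \in <[a i]>.
    have [c [Fc def_x _]] := mem_bigdprod defP Px.
    have Fc' j : c j \in <[a j]> by apply: Fc.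
    by rewrite /w def_x (dprod_projE (F := fun j => <[a j]>%G) i defP).
  rewrite w2 in full; apply: (@not_is_square_in_cycle _ (w ^+ 2)).
  - by rewrite /p_elt /order full; apply: a2.
  - by rewrite -cycle_eq1 full cycle_eq1.
  by exists w; rewrite // full.
case: (boolP [exists i, dprod_proj (fun j => <[a j]>) i @: <[z]> == <[a i]>]).
  by case/existsP=> i /eqP; exists i.
rewrite negb_exists => /forallP nfull; case: nsqz.
have [c [Fc def_z _]] := mem_bigdprod defP Pz.
rewrite def_z; apply: is_square_in_prod => // i.
have /cycleP[k def_k] := Fc i isT.
(* An odd power of the 2-element [a i] would generate [<[a i]>]. *)
have even_k : ~~ odd k.
  apply: contra (nfull i) => odd_k; rewrite projE def_z.
  have Fc' j : c j \in <[a j]> by apply: Fc.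
  rewrite (dprod_projE (F := fun j => <[a j]>%G) i defP) // def_k.
  rewrite eq_sym -/(generator _ _) generator_coprime.
  by apply: (pnat_coprime (a2 i)); rewrite -odd_2'nat.
exists (a i ^+ k./2); first by rewrite (aP i) // mem_cycle.
by rewrite -expgM muln2 even_halfK.
Qed.

End Projections.

Theorem theorem2p7 (gT : finGroupType) (G P H : {group gT})
    (n : nat) (a : 'I_n -> gT) (m : 'I_n -> nat)
    (abelG : abelian G)
    (sylP : 2.-Sylow(G) P)
    (defP : \big[dprod/1]_(i < n) <[a i]> = P)
    (order_a : forall i : 'I_n, #[a i] = (2 ^ m i)%N)
    (a_gt1 : forall i : 'I_n, (1 < 2 ^ m i)%N)
    (sHG : H \subset G)
    (cycHP : cyclic (H :&: P)) :
  (group_perfect_code G H <->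
     H :&: P = 1 \/
     exists i : 'I_n,
       dprod_proj (fun j => <[a j]>) i @: (H :&: P) = <[a i]>) /\
  (group_total_perfect_code G H <->
     exists i : 'I_n,
       dprod_proj (fun j => <[a j]>) i @: (H :&: P) = <[a i]>).
Proof.
have nsHG : H <| G by rewrite -sub_abelian_normal.
have sPG := pHall_sub sylP.
have [z defQ] := cyclicP cycHP.
have Pz : z \in P by rewrite -cycle_subG -defQ subsetIr.
have fullP : (exists i, dprod_proj (fun j => <[a j]>) i @: (H :&: P) = <[a i]>)
    <-> ~ is_square_in P z.
  rewrite defQ; apply: dprod_proj_cycle_fullP => // [|i|i].
  - exact: abelianS abelG.
  - by rewrite /p_elt order_a pnatX.
  by rewrite -order_gt1 order_a.
have codeP := coset_involutive_SylowP abelG sylP sHG defQ.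
have evenP : 2 %| #|H| <-> H :&: P <> 1.
  have sylQ : 2.-Sylow(H) (H :&: P).
    by rewrite setIC (setI_normal_Hall _ sylP) // -sub_abelian_normal.
  have -> : (2 %| #|H|) = (1 < #|H :&: P|).
    by rewrite (card_Hall sylQ) p_part_gt1 mem_primes cardG_gt0.
  rewrite cardG_gt1; split=> [/eqP // | ntQ]; exact/eqP.
have codeE := group_perfect_code_normalP nsHG.
have tcodeE := group_total_perfect_code_normalP nsHG.
(* Hence a full projection forces [H :&: P] to be nontrivial and [H] to have even order. *)
have sqz_triv : H :&: P = 1 -> is_square_in P z.
  move=> Q1; exists 1; rewrite ?group1 // expg1n.
  by apply/esym/eqP; rewrite -cycle_eq1 -defQ Q1.
tauto.
Qed.
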